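(* Let $k\ge 2$ and $n\ge 2$ be integers. Suppose $n^2\le k(n-1)+1$ and suppose $\overline{a}=(k-1)/n$ is an integer. Suppose \[ \gamma=\left\lfloor \frac{k}{\overline{a}+3}\right\rfloor\ge 1. \] Then there is an optimal $\mathsf{OA}_{\lambda}(k,n)$, where \[ \lambda=\binom{k-2}{\overline{a}-1}(n-1)^{k-\overline{a}-1}, \] that can be partitioned into $(n-1)^{\gamma}$ optimal $\mathsf{OA}_{\lambda/(n-1)^{\gamma}}(k,n)$.
   Context: For integers $k\ge 2$, $n\ge 2$, $\lambda\ge 1$, an orthogonal array $\mathsf{OA}_{\lambda}(k,n)$ is a $\lambda n^2$ by $k$ array with entries from a set $X$ of cardinality $n$ such that, within any two distinct columns, every ordered pair of symbols from $X$ occurs in exactly $\lambda$ rows (rows may be repeated). An $\mathsf{OA}_{\lambda}(k,n)$ is optimal if it contains a row that is repeated exactly $m=\frac{\lambda n^2}{k(n-1)+1}$ times (in particular this number is a positive integer). Saying that an array can be partitioned into arrays means that its multiset of rows (counted with multiplicity) can be partitioned into sub-multisets, each of which forms an array of the stated kind on the same symbol set and the same columns. *)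

(* Defs.v *)
From mathcomp Require Import all_boot all_order all_algebra.

Set Implicit Arguments.
Unset Strict Implicit.
Unset Printing Implicit Defensive.

(** [row_mult A r] is the multiplicity of [r] in the multiset of rows of [A]. *)
Definition row_mult (X : finType) (N k : nat) (A : 'M[X]_(N, k))
    (r : 'rV[X]_k) : nat :=
  #|[set i : 'I_N | row i A == r]|.

Definition is_OA (X : finType) (lambda k n : nat)
    (A : 'M[X]_(lambda * n ^ 2, k)) : Prop :=
  [/\ 2 <= k, 2 <= n, 1 <= lambda, #|X| = n &
      forall (c d : 'I_k), c != d -> forall x y : X,
        #|[set i : 'I_(lambda * n ^ 2) | (A i c == x) && (A i d == y)]| = lambda].
Arguments is_OA {X} lambda {k} n A.

(** The divisibility condition makes the truncating [%/] an exact quotient. *)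
Definition is_optimal_OA (X : finType) (lambda k n : nat)
    (A : 'M[X]_(lambda * n ^ 2, k)) : Prop :=
  [/\ is_OA lambda n A,
      k * (n - 1) + 1 %| lambda * n ^ 2 &
      exists r : 'rV[X]_k,
        row_mult A r = (lambda * n ^ 2) %/ (k * (n - 1) + 1)].
Arguments is_optimal_OA {X} lambda {k} n A.

(** The multiset of rows of [A] is the multiset sum of those of the [B i]. *)
Definition row_partition (X : finType) (N M k s : nat)
    (A : 'M[X]_(N, k)) (B : 'I_s -> 'M[X]_(M, k)) : Prop :=
  forall r : 'rV[X]_k, row_mult A r = \sum_(i < s) row_mult (B i) r.

(* Main.v *)
Require Import Defs.
From mathcomp Require Import all_boot all_order all_algebra.
From mathcomp Require Import zify.

Set Implicit Arguments.
Unset Strict Implicit.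
Unset Printing Implicit Defensive.

Import GRing.Theory.

(** Let [q = n - 1], [a = (k - 1) / n], and let the symbols be [option G] with
    [G] an abelian group of order [q]; [None] plays the part of zero.

    The words of length [k] with exactly [a] zeros form almost an orthogonal
    array.  A pair of positions shows a given pair of symbols, of which [i] are
    nonzero, in [D * q ^ (k - a - i)] of them, where [D] counts the possible
    zero sets ([card_words_pair_at]).  Since [k - 1 = a n], these numbers agree
    for [i = 1] and [i = 2], and are the wanted [lambda]; only the pair of two
    zeros falls short, by an amount that does not depend on the positions.
    Adding that many copies of the zero word repairs it, and this amount is
    exactly the multiplicity demanded by optimality.  It is an integer because
    it is a power of [q] times a Fuss-Catalan number ([fuss_catalan]).

    For the partition, cut the columns into [gamma] disjoint blocks of length
    [a + 3], and sort the words by the sums in [G] of the nonzero entries of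
    each block; there are [q ^ gamma] classes.  Prescribe a word at two
    positions.  Its [a] zeros and these two positions cannot fill a block, so
    every block keeps a nonzero entry that may be translated freely.  Such
    translations permute the classes and keep the zero set and the prescribed
    entries, so every class contains the same number of words with the
    prescribed pair ([card_block_sums_class]).  Sharing the zero words equally
    among the classes, each class is itself an optimal array with [lambda]
    divided by [q ^ gamma]. *)

(** * Arrays from lists of rows *)

Definition rows_mx (X : finType) (N k : nat) (r0 : 'rV[X]_k)
    (rs : seq 'rV[X]_k) : 'M[X]_(N, k) :=
  (\matrix_(i < N) nth r0 rs i)%R.

Lemma card_rows_mx (X : finType) (N k : nat) (r0 : 'rV[X]_k) rs
    (P : pred 'rV[X]_k) :
  size rs = N -> #|[set i | P (row i (rows_mx N r0 rs))]| = count P rs.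
Proof.
move=> sz; rewrite -sum1_count (big_nth r0) big_mkord sz -sum1dep_card.
by apply: eq_bigl => i; rewrite rowK.
Qed.

Definition pair_at (X : eqType) (k : nat) (c d : 'I_k) (x y : X)
    (r : 'rV[X]_k) : bool :=
  (r 0%R c == x) && (r 0%R d == y).

(** Every row shows exactly one pair of symbols in columns [c] and [d], so the
    number of rows is forced by the pair counts. *)
Lemma size_of_pair_counts (X : finType) (k lam : nat) (c d : 'I_k)
    (rs : seq 'rV[X]_k) :
  (forall x y, count (pair_at c d x y) rs = lam) -> size rs = lam * #|X| ^ 2.
Proof.
move=> H.
have -> : lam * #|X| ^ 2 = \sum_(p : X * X) count (pair_at c d p.1 p.2) rs.
  rewrite (eq_bigr (fun=> lam)) => [|p _]; last exact: H.
  by rewrite sum_nat_const card_prod mulnC -mulnn.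
under eq_bigr => p _ do rewrite -sum1_count big_mkcond.
rewrite exchange_big -sum1_size; apply: eq_bigr => r _ /=.
rewrite (bigD1 (r 0%R c, r 0%R d)) //= /pair_at !eqxx /= big1 // => -[x y].
rewrite xpair_eqE /= => /negbTE.
by rewrite (eq_sym x) (eq_sym y) => ->.
Qed.

(** Reduces optimality to counting in a list.  The multiplicity condition is
    multiplied out, so that it carries both the divisibility and the value of
    the quotient. *)
Lemma optimal_rows_mx (X : finType) (k n lam : nat) (r0 : 'rV[X]_k)
    (rs : seq 'rV[X]_k) :
  2 <= k -> 2 <= n -> 1 <= lam -> #|X| = n ->
  (forall c d, c != d -> forall x y, count (pair_at c d x y) rs = lam) ->
  count_mem r0 rs * (k * (n - 1) + 1) = lam * n ^ 2 ->
  is_optimal_OA lam n (rows_mx (lam * n ^ 2) r0 rs) /\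
  forall r, row_mult (rows_mx (lam * n ^ 2) r0 rs) r = count_mem r rs.
Proof.
move=> hk hn hlam cX Hpair Hr0.
have sz : size rs = lam * n ^ 2.
  have k0 : 0 < k by apply: leq_trans hk.
  rewrite -cX; apply: (@size_of_pair_counts _ _ _ (Ordinal k0) (Ordinal hk)).
  exact: Hpair.
have mult r : row_mult (rows_mx (lam * n ^ 2) r0 rs) r = count_mem r rs.
  exact: (card_rows_mx r0 (pred1 r) sz).
split=> //; split.
- split=> // c d ncd x y; apply: etrans (Hpair c d ncd x y).
  rewrite -(card_rows_mx r0 _ sz).
  by apply: eq_card => i; rewrite !inE /pair_at !mxE.
- by rewrite -Hr0 dvdn_mull.
- by exists r0; rewrite mult -Hr0 mulnK // addn1.
Qed.

(** * Words with a given number of zeros *)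

Lemma card_subsets_avoiding (T : finType) (B : {set T}) (a : nat) :
  #|[set Z : {set T} | (#|Z| == a) && [disjoint Z & B]]| = 'C(#|T| - #|B|, a).
Proof.
rewrite -[in LHS](setCK B) -[in RHS](setCK B) -cardsCs -cards_draws.
by apply: eq_card => Z; rewrite !inE andbC disjoints_subset setCK.
Qed.

(** Only sets that avoid given points are counted directly; the other cases
    follow from these by inclusion-exclusion and Pascal's rule.  For two
    members this gives [C(k+1, a) - C(k, a)], which is correct even for
    [a = 0], where the direct count [C(k, a - 1)] would fail because of the
    truncated subtraction. *)
Lemma card_zero_sets (k a : nat) (c d : 'I_k.+2) (bx by_ : bool) :
  c != d ->
  #|[set Z : {set 'I_k.+2} |
      [&& #|Z| == a.+1, (c \in Z) == bx & (d \in Z) == by_]]| =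
  if bx && by_ then 'C(k.+1, a) - 'C(k, a)
  else if bx || by_ then 'C(k, a) else 'C(k, a.+1).
Proof.
move=> ncd.
pose N bx by_ := #|[set Z : {set 'I_k.+2} |
      [&& #|Z| == a.+1, (c \in Z) == bx & (d \in Z) == by_]]|.
have Nff : N false false = 'C(k, a.+1).
  have -> : 'C(k, a.+1) = 'C(#|'I_k.+2| - #|[set c; d]|, a.+1).
    by rewrite cards2 ncd card_ord subn2.
  rewrite -card_subsets_avoiding; apply: eq_card => Z.
  rewrite !inE disjoint_sym disjoints_subset subUset !sub1set !inE.
  by rewrite !eqbF_neg.
have avoid1 e : #|[set Z : {set 'I_k.+2} | (#|Z| == a.+1) && (e \notin Z)]| =
                'C(k.+1, a.+1).
  have -> : 'C(k.+1, a.+1) = 'C(#|'I_k.+2| - #|[set e]|, a.+1).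
    by rewrite cards1 card_ord subn1.
  rewrite -card_subsets_avoiding; apply: eq_card => Z.
  by rewrite !inE disjoint_sym disjoints1.
have splitd bx' : N bx' false + N bx' true =
    #|[set Z : {set 'I_k.+2} | (#|Z| == a.+1) && ((c \in Z) == bx')]|.
  rewrite -[RHS](cardsID [set Z : {set _} | d \in Z]) addnC /N.
  by congr (_ + _); apply: eq_card => Z; rewrite !inE;
     case: (d \in Z); case: (#|Z| == _); case: (c \in Z); case: bx'.
have Nd : N false false + N true false = 'C(k.+1, a.+1).
  rewrite -(avoid1 d) -[RHS](cardsID [set Z : {set _} | c \in Z]) addnC /N.
  by congr (_ + _); apply: eq_card => Z; rewrite !inE;
     case: (d \in Z); case: (#|Z| == _); case: (c \in Z).
have Nc : N false false + N false true = 'C(k.+1, a.+1).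
  rewrite splitd -(avoid1 c); apply: eq_card => Z; rewrite !inE.
  by rewrite eqbF_neg.
have Nall : N false false + N false true + (N true false + N true true) =
            'C(k.+2, a.+1).
  have <- : #|[set Z : {set 'I_k.+2} | #|Z| == a.+1]| = 'C(k.+2, a.+1).
    by rewrite card_draws card_ord.
  rewrite !splitd -[RHS](cardsID [set Z : {set _} | c \in Z]) addnC.
  by congr (_ + _); apply: eq_card => Z; rewrite !inE;
     case: (c \in Z); case: (#|Z| == _).
have p1 := binS k.+1 a; have p2 := binS k a.
rewrite -/(N bx by_); case: bx; case: by_ => /=; lia.
Qed.

Definition zeros (G : finType) (k : nat) (w : 'rV[option G]_k) : {set 'I_k} :=
  [set i | w 0%R i == None].

Lemma card_row_family (X : finType) (k : nat) (F : 'I_k -> pred X) :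
  #|[set w : 'rV[X]_k | [forall i, w 0%R i \in F i]]| = \prod_i #|F i|.
Proof.
have -> : \prod_i #|F i| = #|family F|.
  by rewrite card_family foldrE big_map big_enum.
pose h (w : 'rV[X]_k) : {ffun 'I_k -> X} := [ffun i => w 0%R i].
have hI : injective h.
  by move=> v w /ffunP e; apply/rowP => i; have := e i; rewrite !ffunE.
rewrite -(card_imset _ hI); apply: eq_card => f.
apply/imsetP/familyP => [[w] | Hf].
  by rewrite inE => /forallP Hw -> i; rewrite ffunE.
exists (\row_i f i)%R; last by apply/ffunP => i; rewrite ffunE mxE.
by rewrite inE; apply/forallP => i; rewrite mxE.
Qed.

(** Outside [c], [d] and [Z] an entry is an arbitrary nonzero symbol, and all
    other entries are determined. *)
Lemma card_words_with_zeros (G : finType) (k : nat) (c d : 'I_k)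
    (x y : option G) (Z : {set 'I_k}) :
  c != d -> (c \in Z) = (x == None) -> (d \in Z) = (y == None) ->
  #|[set w : 'rV[option G]_k | (zeros w == Z) && pair_at c d x y w]| =
  #|G| ^ (k - #|Z| - (x != None) - (y != None)).
Proof.
move=> ncd cZ dZ.
have [F inF] : exists F : 'I_k -> pred (option G), forall i v, (v \in F i) =
    [&& (v == None) == (i \in Z), (i == c) ==> (v == x)
      & (i == d) ==> (v == y)].
  by eexists => i v; rewrite -topredE.
transitivity #|[set w : 'rV[option G]_k | [forall i, w 0%R i \in F i]]|.
  apply: eq_card => w; rewrite !inE; apply/andP/forallP => [[/eqP wZ] | Hw].
    case/andP=> /eqP wc /eqP wd i; rewrite inF -wZ -wc -wd inE eqxx /=.
    by apply/andP; split; apply/implyP => /eqP ->.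
  split.
    by apply/eqP/setP => i; have := Hw i; rewrite inF inE => /and3P[/eqP].
  move: (Hw c) (Hw d); rewrite !inF !eqxx /pair_at /=.
  by move=> /and3P[_ -> _] /and3P[_ _ ->].
rewrite card_row_family.
rewrite (eq_bigr (fun i =>
  if i \in ~: (Z :|: [set c; d]) then #|G| else 1)); last first.
  move=> i _.
  have -> : (i \in ~: (Z :|: [set c; d])) = [&& i \notin Z, i != c & i != d].
    by rewrite !inE !negb_or.
  have [-> | nic] /= := eqVneq i c.
    rewrite andbF; apply: etrans (card1 x); apply: eq_card => v.
    rewrite inF inE eqxx (negbTE ncd) /= andbT cZ.
    by have [-> | //] := eqVneq v x; rewrite ?eqxx // andbF.
  have [-> | nid] /= := eqVneq i d.
    rewrite andbF; apply: etrans (card1 y); apply: eq_card => v.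
    rewrite inF inE eqxx [d == c]eq_sym (negbTE ncd) /= dZ.
    by have [-> | //] := eqVneq v y; rewrite ?eqxx // andbF.
  rewrite andbT; case: (boolP (i \in Z)) => iZ /=.
    apply: etrans (card1 (None : option G)); apply: eq_card => v.
    by rewrite inF !inE (negbTE nic) (negbTE nid) iZ /= !andbT eqb_id.
  have -> : #|G| = #|[pred v : option G | v != None]|.
    have := cardC1 (None : option G); rewrite card_option /= => <-.
    by apply: eq_card => v; rewrite !inE.
  apply: eq_card => v.
  by rewrite inF !inE (negbTE nic) (negbTE nid) (negbTE iZ) /= !andbT eqbF_neg.
rewrite -big_mkcond prod_nat_const; congr (_ ^ _).
rewrite cardsCs setCK card_ord -!subnDA; congr (_ - _).
rewrite setUC -setUA !cardsU1 !inE (negbTE ncd) cZ dZ /=.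
lia.
Qed.

Lemma card_words_pair_at (G : finType) (k a : nat) (c d : 'I_k.+2)
    (x y : option G) :
  c != d ->
  #|[set w : 'rV[option G]_k.+2 | (#|zeros w| == a.+1) && pair_at c d x y w]| =
  (if (x == None) && (y == None) then 'C(k.+1, a) - 'C(k, a)
   else if (x == None) || (y == None) then 'C(k, a) else 'C(k, a.+1)) *
  #|G| ^ (k.+2 - a.+1 - (x != None) - (y != None)).
Proof.
move=> ncd; rewrite -(card_zero_sets a _ _ ncd).
set S := [set Z : {set _} | _].
rewrite -sum1_card (partition_big (@zeros G k.+2) (mem S)) /=; last first.
  move=> w; rewrite !inE => /and3P[-> /eqP <- /eqP <-].
  by rewrite !eqxx.
rewrite -sum_nat_const; apply: eq_bigr => Z; rewrite inE.
case/and3P=> /eqP <- /eqP cZ /eqP dZ.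
rewrite -(card_words_with_zeros ncd cZ dZ) -sum1dep_card.
apply: eq_bigl => w; rewrite !inE.
by have [-> | _] := eqVneq (zeros w) Z; rewrite ?eqxx ?andbT ?andbF.
Qed.

(** * Block sums *)

Definition block_sums (G : finZmodType) (J : finType) (k : nat)
    (blk : 'I_k -> option J) (w : 'rV[option G]_k) : {ffun J -> G} :=
  [ffun j => (\sum_(i | blk i == Some j) odflt 0 (w 0 i))%R].

(** The choice depends on the word only through its set of zeros: [B] will be
    the zero set enlarged by protected positions.  A translation of nonzero
    entries preserves that set, so it does not move its own pivots. *)
Definition pivot (J : finType) (k : nat) (blk : 'I_k -> option J)
    (B : {set 'I_k}) (j : J) : option 'I_k :=
  [pick i | (blk i == Some j) && (i \notin B)].

(** Translates one unprotected nonzero entry in each block that has any, so as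
    to add [u] to the sums of these blocks; [E] is the set of protected
    positions. *)
Definition shift (G : finZmodType) (J : finType) (k : nat)
    (blk : 'I_k -> option J) (E : {set 'I_k}) (u : {ffun J -> G})
    (w : 'rV[option G]_k) : 'rV[option G]_k :=
  (\row_i if blk i is Some j then
            if pivot blk (zeros w :|: E) j == Some i
            then omap (fun g => g + u j) (w 0 i) else w 0 i
          else w 0 i)%R.

Lemma zeros_shift (G : finZmodType) (J : finType) (k : nat)
    (blk : 'I_k -> option J) (E : {set 'I_k}) u (w : 'rV[option G]_k) :
  zeros (shift blk E u w) = zeros w.
Proof.
apply/setP => i; rewrite !inE mxE.
by case: (blk i) => // j; case: ifP => // _; case: (w _ i).
Qed.

(** The pivots of [w] and of its shift coincide, since both have the same
    zeros. *)
Lemma shiftK (G : finZmodType) (J : finType) (k : nat)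
    (blk : 'I_k -> option J) (E : {set 'I_k}) (u : {ffun J -> G}) :
  cancel (shift blk E u) (shift blk E (- u)%R).
Proof.
move=> w; apply/rowP => i; rewrite mxE zeros_shift !mxE.
case: (blk i) => // j; case: (pivot _ _ _ == _) => //.
by case: (w _ i) => //= g; rewrite ffunE addrK.
Qed.

Lemma shift_fixed (G : finZmodType) (J : finType) (k : nat)
    (blk : 'I_k -> option J) (E : {set 'I_k}) u (w : 'rV[option G]_k) i :
  i \in E -> shift blk E u w 0%R i = w 0%R i.
Proof.
move=> iE; rewrite mxE; case: (blk i) => // j.
rewrite /pivot; case: pickP => [i' /andP[_] | //].
rewrite inE negb_or => /andP[_ ni'E].
by case: eqP => // -[e]; rewrite e iE in ni'E.
Qed.

(** The size hypothesis leaves an available pivot in every block, and only this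
    entry of the block changes. *)
Lemma block_sums_shift (G : finZmodType) (J : finType) (k : nat)
    (blk : 'I_k -> option J) (E : {set 'I_k}) u (w : 'rV[option G]_k) :
  (forall j, #|zeros w| + #|E| < #|[set i | blk i == Some j]|) ->
  block_sums blk (shift blk E u w) = (block_sums blk w + u)%R.
Proof.
move=> big; apply/ffunP => j; rewrite !ffunE.
case Ep: (pivot blk (zeros w :|: E) j) => [p|]; last first.
  move: Ep; rewrite /pivot; case: pickP => // Hno _.
  have sub : [set i | blk i == Some j] \subset zeros w :|: E.
    apply/subsetP => i; rewrite inE => bi; have := Hno i.
    by rewrite bi => /negbFE.
  have := leq_trans (big j) (subset_leq_card sub).
  by rewrite cardsU ltnNge leq_subr.
have /andP[bp np] : (blk p == Some j) && (p \notin zeros w :|: E).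
  by move: Ep; rewrite /pivot; case: pickP => // i Hi [<-].
rewrite (bigD1 p) //= [X in (_ = X + _)%R](bigD1 p) //=.
rewrite mxE (eqP bp) Ep eqxx.
move: np; rewrite !inE negb_or => /andP[].
case: (w 0%R p) => //= g _ _; rewrite -!addrA; congr (_ + _)%R.
rewrite addrC; congr (_ + _)%R; apply: eq_bigr => i /andP[/eqP bi nip].
by rewrite mxE bi Ep (inj_eq Some_inj) eq_sym (negbTE nip).
Qed.

(** The shift by [t2 - t1] that protects [c] and [d] injects the class of [t1]
    into that of [t2], so all classes are equally large. *)
Lemma card_block_sums_class (G : finZmodType) (J : finType) (k a : nat)
    (blk : 'I_k -> option J) (c d : 'I_k) (x y : option G)
    (t : {ffun J -> G}) :
  (forall j, a + 3 <= #|[set i | blk i == Some j]|) ->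
  #|[set w : 'rV[option G]_k |
      [&& #|zeros w| == a, block_sums blk w == t & pair_at c d x y w]]| *
  #|G| ^ #|J| =
  #|[set w : 'rV[option G]_k | (#|zeros w| == a) && pair_at c d x y w]|.
Proof.
move=> big.
pose W t := [set w : 'rV[option G]_k |
  [&& #|zeros w| == a, block_sums blk w == t & pair_at c d x y w]].
have le t1 t2 : #|W t1| <= #|W t2|.
  pose f := shift blk [set c; d] (t2 - t1)%R.
  have fI : injective f by apply: can_inj; exact: shiftK.
  rewrite -(card_imset (mem (W t1)) fI).
  apply/subset_leq_card/subsetP => _ /imsetP[w Hw ->].
  move: Hw; rewrite !inE => /and3P[/eqP za /eqP lt pw].
  rewrite zeros_shift za eqxx /pair_at !shift_fixed ?inE ?eqxx ?orbT //.
  rewrite -/(pair_at c d x y w) pw andbT block_sums_shift ?lt.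
    by rewrite addrC subrK eqxx.
  move=> j; apply: leq_trans (big j); rewrite za cards2.
  by case: (c != d); lia.
rewrite -card_ffun mulnC -sum_nat_const.
rewrite -[RHS]sum1_card (partition_big (block_sums blk) xpredT) //=.
apply: eq_bigr => t' _.
rewrite -/(W t); have -> : #|W t| = #|W t'|.
  by apply/eqP; rewrite eqn_leq !le.
rewrite -sum1_card; apply: eq_bigl => w; rewrite !inE.
by rewrite andbAC andbA.
Qed.

(** * Optimal arrays from classes of block sums *)

Definition class_rows (G : finZmodType) (J : finType) (k : nat)
    (blk : 'I_k -> option J) (a m : nat) (t : {ffun J -> G}) :
    seq 'rV[option G]_k :=
  enum [set w | (#|zeros w| == a) && (block_sums blk w == t)] ++
  nseq m (const_mx None).

Lemma count_class_rows (G : finZmodType) (J : finType) (k : nat)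
    (blk : 'I_k -> option J) (a m : nat) (t : {ffun J -> G})
    (P : pred 'rV[option G]_k) :
  count P (class_rows blk a m t) =
  #|[set w | [&& #|zeros w| == a, block_sums blk w == t & P w]]| +
  P (const_mx None) * m.
Proof.
rewrite count_cat count_nseq; congr (_ + _).
rewrite -sum1_count big_enum_cond sum1dep_card.
by apply: eq_card => w; rewrite !inE andbA.
Qed.

(** The witness is the Fuss-Catalan number [C(an, a) / (a(n-1) + 1)], written
    with [k + 2], [a + 1] and [q + 1] for [k], [a] and [n].  It is an integer
    because [k - a = a q + 1] is coprime to [a].  The second equation is the
    multiplicity of the zero word; both together settle the pair of two
    zeros. *)
Lemma fuss_catalan (k a q : nat) :
  k.+1 = a.+1 * q.+1 ->
  exists2 m, 'C(k.+1, a) = a.+1 * m &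
             m * (k.+2 - a.+1) = q.+1 * 'C(k, a).
Proof.
move=> Ek.
have Ed : k.+2 - a.+1 = a.+1 * q + 1 by lia.
have E : k.+1 * 'C(k, a) = (k.+2 - a.+1) * 'C(k.+1, a) by rewrite mul_bin_down.
have : a.+1 %| 'C(k.+1, a).
  have co : coprime a.+1 (k.+2 - a.+1).
    by rewrite /coprime Ed mulnC gcdnMDl gcdn1.
  by rewrite -(Gauss_dvdr _ co) -E Ek -mulnA dvdn_mulr.
case/dvdnP=> m Em; exists m; first by rewrite mulnC.
apply/eqP; rewrite -(eqn_pmul2l (ltn0Sn a)); apply/eqP.
by rewrite !mulnA -Ek E Em; lia.
Qed.

(** Every class of words receives [m] zero words.  Pair counts are compared
    after multiplication by the number [#|G| ^ #|J|] of classes, which turns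
    the count in a class into the count over all words. *)
Lemma class_rows_counts (G : finZmodType) (J : finType) (k a : nat)
    (blk : 'I_k.+2 -> option J) :
  k.+1 = a.+1 * #|G|.+1 ->
  (forall j, a.+1 + 3 <= #|[set i | blk i == Some j]|) ->
  #|J| + a.+2 <= k.+2 ->
  let lam := 'C(k, a) * #|G| ^ (k.+2 - a.+2 - #|J|) in
  exists m, forall t : {ffun J -> G},
    (forall c d, c != d -> forall x y,
       count (pair_at c d x y) (class_rows blk a.+1 m t) = lam) /\
    count_mem (const_mx None) (class_rows blk a.+1 m t) * (k.+2 * #|G| + 1) =
    lam * #|G|.+1 ^ 2.
Proof.
move=> Ek big hJ lam.
have q0 : 0 < #|G| by apply/card_gt0P; exists 0%R.
have [m0 Em1 Em2] := fuss_catalan Ek.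
have Ed : k.+2 - a.+1 = a.+1 * #|G| + 1 by lia.
have EC : 'C(k, a.+1) = #|G| * 'C(k, a).
  apply/eqP; rewrite -(eqn_pmul2l (ltn0Sn a)) mul_bin_left mulnA.
  by have -> : k - a = a.+1 * #|G| by lia.
exists (m0 * #|G| ^ (k.+2 - a.+2 - #|J|)) => t; split=> [c d ncd x y|].
  rewrite count_class_rows.
  have s0 : 0 < #|G| ^ #|J| by rewrite expn_gt0 q0.
  apply/eqP; rewrite -(eqn_pmul2r s0) mulnDl.
  rewrite (card_block_sums_class c d x y t big) (card_words_pair_at a x y ncd).
  rewrite /lam -!mulnA -expnD subnK; last by lia.
  rewrite /pair_at !mxE !(eq_sym None).
  (* With [e + 2] for the number of nonzero entries, no exponent truncates. *)
  have [e Ee] : exists e, k.+2 - a.+1 = e.+2.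
    have : 0 < a.+1 * #|G| by rewrite muln_gt0.
    by rewrite Ed; exists (a.+1 * #|G|).-1; lia.
  have -> : k.+2 - a.+2 = e.+1 by lia.
  rewrite Ee in Ed Em2 *.
  case: (x == None); case: (y == None); rewrite /= ?subn0 ?subn1 /=.
  (* Two zeros: the only pair that the zero words contribute to. *)
  - have leC : 'C(k, a) <= a.+1 * m0 by rewrite -Em1 leq_bin2l.
    have {}leC := leq_mul leC (leqnn #|G|).
    have E : (a.+1 * m0 - 'C(k, a)) * #|G| + m0 = 'C(k, a).
      by rewrite mulnBl; rewrite Ed in Em2; lia.
    by rewrite mul1n Em1 expnS mulnA -mulnDl E.
  - by rewrite mul0n addn0.
  - by rewrite mul0n addn0.
  - by rewrite mul0n addn0 EC expnS -mulnA mulnCA.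
rewrite count_class_rows.
(* The zero word has too many zeros to occur among the words of the class. *)
have -> : #|[set w : 'rV[option G]_k.+2 | [&& #|zeros w| == a.+1,
      block_sums blk w == t & pred1 (const_mx None) w]]| = 0.
  apply: eq_card0 => w; rewrite !inE; apply/negP => /and3P[/eqP za _ /eqP w0].
  have : #|zeros w| = k.+2.
    rewrite -[RHS](card_ord k.+2); apply: eq_card => i.
    by rewrite inE w0 mxE.
  by rewrite za => ea; lia.
rewrite /= eqxx add0n mul1n /lam.
have -> : k.+2 * #|G| + 1 = (k.+2 - a.+1) * #|G|.+1.
  by rewrite Ed -[k.+2]addn1 Ek; lia.
by rewrite mulnACA Em2 -mulnn [RHS]mulnC [RHS]mulnACA (mulnC (_ ^ _)).
Qed.

(** Positions beyond the last complete block have a quotient out of range and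
    belong to no block. *)
Lemma consecutive_blocks (k b : nat) (j : 'I_(k.+1 %/ b)) :
  b <= #|[set i : 'I_k.+1 | insub (i %/ b) == Some j]|.
Proof.
have b0 : 0 < b by case: b j => // -[].
have lt (r : 'I_b) : j * b + r < k.+1.
  apply: leq_trans (leq_trunc_div k.+1 b).
  have := leq_mul (ltn_ord j) (leqnn b); have := ltn_ord r; lia.
pose h r := Ordinal (lt r).
have hI : injective h by move=> r1 r2 [] /addnI /val_inj.
apply: (@leq_trans #|h @: 'I_b|); first by rewrite card_imset // card_ord.
apply/subset_leq_card/subsetP => _ /imsetP[r _ ->].
have e : h r %/ b = j by rewrite /= divnMDl // (divn_small (ltn_ord r)) addn0.
by rewrite inE e valK.
Qed.

Theorem theorem4p5 (k n : nat) (hk : 2 <= k) (hn : 2 <= n)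
    (hkn : n ^ 2 <= k * (n - 1) + 1) (hdvd : n %| k - 1) :
  let a := (k - 1) %/ n in
  let gamma := k %/ (a + 3) in
  let lambda := 'C(k - 2, a - 1) * (n - 1) ^ (k - a - 1) in
  let s := (n - 1) ^ gamma in
  1 <= gamma ->
  s %| lambda /\
  exists (X : finType) (A : 'M[X]_(lambda * n ^ 2, k)),
    is_optimal_OA lambda n A /\
    exists B : 'I_s -> 'M[X]_((lambda %/ s) * n ^ 2, k),
      (forall i : 'I_s, is_optimal_OA (lambda %/ s) n (B i)) /\ row_partition A B.
Proof.
move=> a gamma; rewrite {}/gamma.
have Ek : k - 1 = a * n by rewrite /a divnK.
move: a Ek => a Ek.
clear hdvd hkn.
case: k hk Ek => [|[|k]] // _; rewrite subSS subn0 => Ek.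
case: n hn Ek => [|[|p]] // _ Ek.
case: a Ek => [|a] Ek; first by rewrite mul0n in Ek.
rewrite !subSS !subn0; set gamma := k.+2 %/ _; set s := _ ^ gamma.
set lambda := 'C(k, a) * _ => gamma1.
pose G : finZmodType := 'I_p.+1.
have cG : #|G| = p.+1 by rewrite card_ord.
have cX : #|{: option G}| = p.+2 by rewrite card_option cG.
pose blk (i : 'I_k.+2) : option 'I_gamma := insub (i %/ (a.+1 + 3)).
have hJ : #|'I_gamma| + a.+2 <= k.+2.
  rewrite card_ord; have := leq_trunc_div k.+2 (a.+1 + 3); rewrite -/gamma.
  by move: (gamma) gamma1 => [|g] // _; nia.
have [] := class_rows_counts (G := G) (a := a) (blk := blk) _ _ hJ.
- by rewrite cG.
- exact: consecutive_blocks.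
rewrite cG card_ord; set lam := 'C(k, a) * _ => m Hm.
have Es : #|{: {ffun 'I_gamma -> G}}| = s by rewrite card_ffun cG card_ord.
have s0 : 0 < s by rewrite expn_gt0.
have Elam : lambda = s * lam.
  rewrite /lambda /s /lam mulnCA -expnD subnKC; last first.
    by rewrite card_ord in hJ; lia.
  by congr (_ * _ ^ _); lia.
have lam1 : 0 < lam.
  by rewrite /lam muln_gt0 bin_gt0 expn_gt0 andbT -ltnS Ek leq_pmulr.
have -> : lambda %/ s = lam by rewrite Elam mulKn.
split; first by rewrite Elam dvdn_mulr.
pose r0 : 'rV[option G]_k.+2 := const_mx None.
pose rs (i : 'I_s) := class_rows blk a.+1 m (enum_val (cast_ord (esym Es) i)).
pose all_rows := flatten [seq rs i | i <- enum 'I_s].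
have count_all P : count P all_rows = \sum_i count P (rs i).
  by rewrite count_flatten sumnE 2!big_map big_enum.
have hB i := @optimal_rows_mx _ k.+2 p.+2 lam r0 (rs i) isT isT lam1 cX
               (Hm _).1 (Hm _).2.
have [] := @optimal_rows_mx _ k.+2 p.+2 lambda r0 all_rows isT isT _ cX.
- by rewrite Elam muln_gt0 s0.
- move=> c d ncd x y; rewrite count_all Elam -[X in X * _]card_ord.
  rewrite -sum_nat_const.
  by apply: eq_bigr => i _; apply: (Hm _).1.
- rewrite count_all big_distrl /= Elam -[X in X * _ * _]card_ord -mulnA.
  by rewrite -sum_nat_const; apply: eq_bigr => i _; apply: (Hm _).2.
move=> optA multA.
exists (option G : finType), (rows_mx (lambda * p.+2 ^ 2) r0 all_rows).
split=> //.
exists (fun i => rows_mx (lam * p.+2 ^ 2) r0 (rs i)); split=> [i | r].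
  exact: (hB i).1.
by rewrite multA count_all; apply: eq_bigr => i _; rewrite (hB i).2.
Qed.
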